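(* Let $H=\prod_p p^{a_p}<H'=\prod_p p^{b_p}$ be consecutive highly composite numbers with $L_-(H,H')=2$. Put $g=\gcd(H,H')$, $\delta=d(g)/d(H)$ and $m=L_+(H,H')$. If the two required deletion layers lie in distinct prime coordinates, let $t$ be the smaller of the two primes; if they lie in one coordinate, let $t$ be that prime. If $$\delta\,G_H(t,m)\le 1,$$ then there is a required insertion with prime base $q\ge t$ (i.e. a prime $q\ge t$ with $b_q>a_q$), and therefore $$\beta^{\mathrm{geo}}(H,H')\ge\frac12.$$
   Context: $d(n)$ denotes the number of positive divisors of $n$. A positive integer $H$ is highly composite if $d(m)<d(H)$ for all integers $1\le m<H$. Two highly composite numbers $H<H'$ are consecutive if no highly composite number lies strictly between them. Put $L_-(H,H')=\sum_p\max(a_p-b_p,0)$ and $L_+(H,H')=\sum_p\max(b_p-a_p,0)$. The required deletion layers are the pairs $(p,j)$ with $b_p<j\le a_p$; the coordinate of $(p,j)$ is $p$. For a prime $t$ and an integer $m\ge0$, the left packing functional is $$G_H(t,m)=\max\ \prod_{q<t}\frac{a_q+x_q+1}{a_q+1},$$ where $q$ runs over the primes less than $t$ and the maximum is over nonnegative integers $(x_q)_{q<t}$ with $\sum_{q<t}x_q=m$; if $t=2$ and $m>0$ the feasible set is empty and $G_H(2,m):=0$. An exponent-lattice geodesic from $H$ to $H'$ is a sequence of positive integers starting at $H$ and ending at $H'$ in which each step changes the exponent of exactly one prime by one unit, always in the direction of its target exponent. It is $H'$-admissible if every vertex $z$ satisfies $z\le H'$. The normalised geodesic capacity is $$\beta^{\mathrm{geo}}(H,H')=\frac{1}{d(H)}\max_{\gamma}\min_{z\in\gamma}d(z),$$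 where $\gamma$ ranges over the $H'$-admissible geodesics from $H$ to $H'$ and $z$ over all vertices of $\gamma$, endpoints included. *)

(* Defs.v *)
From mathcomp Require Import all_boot all_order all_algebra.
From mathcomp Require Import zify.

Set Implicit Arguments.
Unset Strict Implicit.
Unset Printing Implicit Defensive.

Import Order.TTheory GRing.Theory Num.Theory.

Definition ndiv (n : nat) : nat := size (divisors n).

Definition highly_composite (H : nat) : Prop :=
  0 < H /\ forall m : nat, 1 <= m < H -> ndiv m < ndiv H.

Definition consecutive_hc (H H' : nat) : Prop :=
  [/\ highly_composite H, highly_composite H', H < H' &
      ~ exists K : nat, highly_composite K /\ H < K < H'].

(* The exponent of p in n is logn p n, and truncated subtraction on nat is
   max(a - b, 0).  For H, H' > 0 the primes outside primes (H * H') have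
   exponent 0 in both numbers and contribute nothing to these sums. *)
Definition L_minus (H H' : nat) : nat :=
  \sum_(p <- primes (H * H')) (logn p H - logn p H').

Definition L_plus (H H' : nat) : nat :=
  \sum_(p <- primes (H * H')) (logn p H' - logn p H).

Definition required_deletion (H H' p j : nat) : bool :=
  prime p && (logn p H' < j <= logn p H).

Definition required_insertion (H H' q : nat) : bool :=
  prime q && (logn q H < logn q H').

(* The coordinates x q are at most m because they sum to m.  The values of x at
   the non-prime q < t are unconstrained and do not enter the product.  All the
   products are positive, so the default 0 is the maximum only when there is no
   feasible x, that is, when t has no smaller prime and m > 0. *)
Definition packing (H t m : nat) : rat :=
  (\big[Num.max/0]_(x : {ffun 'I_t -> 'I_m.+1} |
      (\sum_(q < t | prime q) x q == m)%N)
    \prod_(q < t | prime q) ((logn q H + x q).+1%:R / (logn q H).+1%:R))%R.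

(* A prime whose exponent differs between z > 0 and z' > 0 divides z * z'. *)
Definition geo_step (H' z z' : nat) : bool :=
  has (fun p => ((logn p z < logn p H') && (z' == z * p))
             || ((logn p H' < logn p z) && (z == z' * p)))
      (primes (z * z')).

(* A sequence of vertices is represented by H :: s. *)
Definition geodesic (H H' : nat) (s : seq nat) : bool :=
  [&& all (fun z => 0 < z) (H :: s), path (geo_step H') H s & last H s == H'].

Definition admissible (H H' : nat) (s : seq nat) : bool :=
  all (fun z => z <= H') (H :: s).

(* The start H is accounted for by the initial value of the minimum. *)
Definition min_ndiv (H : nat) (s : seq nat) : nat :=
  \big[minn/ndiv H]_(z <- s) ndiv z.

(* Finitely many sequences suffice: every geodesic has exactly
   L_minus H H' + L_plus H H' steps (size_geodesic), and the vertices of an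
   admissible one are at most H'.  See min_ndiv_le_capacity and
   capacity_attained. *)
Definition geo_capacity (H H' : nat) : nat :=
  \max_(u : (L_minus H H' + L_plus H H').-tuple 'I_H'.+1 |
      geodesic H H' (map val u) && admissible H H' (map val u))
    min_ndiv H (map val u).

Definition beta_geo (H H' : nat) : rat :=
  ((geo_capacity H H')%:R / (ndiv H)%:R)%R.

Lemma sum_primesE (F : nat -> nat) (n N : nat) :
    0 < n -> n < N -> (forall p, prime p -> ~~ (p %| n) -> F p = 0) ->
  \sum_(p <- primes n) F p = \sum_(0 <= p < N | prime p) F p.
Proof.
move=> n0 nN F0.
have -> : \sum_(p <- primes n) F p
          = \sum_(p <- [seq q <- index_iota 0 N | q \in primes n]) F p.
  apply: perm_big; apply: uniq_perm; rewrite ?filter_uniq ?iota_uniq ?primes_uniq //.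
  move=> p; rewrite mem_filter mem_index_iota /=.
  case pn: (p \in primes n) => //=.
  move: pn; rewrite mem_primes => /and3P[_ _ pn].
  by rewrite (leq_ltn_trans (dvdn_leq n0 pn) nN).
rewrite big_filter big_mkcond [RHS]big_mkcond.
apply: eq_bigr => p _; rewrite mem_primes n0 /=.
by case: (boolP (prime p)) => //= pp; case: (boolP (p %| n)) => //= /(F0 p pp).
Qed.

Lemma L_sumE (H H' N : nat) : 0 < H -> 0 < H' -> H * H' < N ->
  L_minus H H' + L_plus H H' =
  \sum_(0 <= p < N | prime p)
    ((logn p H - logn p H') + (logn p H' - logn p H)).
Proof.
move=> H0 H'0 HN; rewrite /L_minus /L_plus -big_split /=.
apply: sum_primesE => //; first by rewrite muln_gt0 H0.
move=> p pp; rewrite Euclid_dvdM // negb_or => /andP[pH pH'].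
have l0 x : ~~ (p %| x) -> logn p x = 0.
  by move=> px; rewrite lognE (negbTE px) !andbF.
by rewrite !l0.
Qed.

Lemma geo_step_dist (H' z z' : nat) : 0 < z -> 0 < z' -> 0 < H' ->
  geo_step H' z z' ->
  L_minus z H' + L_plus z H' = (L_minus z' H' + L_plus z' H').+1.
Proof.
move=> z0 z'0 H'0 /hasP[p]; rewrite mem_primes => /and3P[pp _ pzz'] st.
pose N := (z * H' + z' * H' + p).+1.
have N1 : z * H' < N by rewrite ltnS -addnA leq_addr.
have N2 : z' * H' < N by rewrite ltnS addnAC leq_addl.
have pN : p < N by rewrite ltnS leq_addl.
rewrite (L_sumE z0 H'0 N1) (L_sumE z'0 H'0 N2).
rewrite !big_mkord (bigD1 (Ordinal pN)) // [in RHS](bigD1 (Ordinal pN)) //=.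
have lp x q : 0 < x -> prime q -> logn q (x * p) = logn q x + (q == p).
  by move=> x0 qp; rewrite (lognM q x0 (prime_gt0 pp)) (logn_prime q pp).
have oth (q : 'I_N) : prime q -> q != Ordinal pN -> logn q z = logn q z'.
  move=> qp; rewrite -val_eqE /= => qne.
  by case/orP: st => /andP[_ /eqP ->]; rewrite lp // (negbTE qne) addn0.
rewrite -addSn; congr (_ + _).
  by case/orP: st => /andP[lt /eqP e]; move: lt; rewrite e lp // eqxx; lia.
by apply: eq_bigr => q /andP[qp qne]; rewrite oth.
Qed.

Lemma size_geodesic (H H' : nat) (s : seq nat) :
  geodesic H H' s -> size s = L_minus H H' + L_plus H H'.
Proof.
case/and3P => pos st /eqP lst.
have H'0 : 0 < H' by rewrite -lst; apply: (allP pos); apply: mem_last.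
elim: s H pos st lst => [|z s IH] H /= pos st lst.
  by rewrite lst /L_minus /L_plus !big1_seq // => p _; rewrite subnn.
case/and3P: pos => H0 z0 pos; case/andP: st => st1 st2.
by rewrite (geo_step_dist H0 z0 H'0 st1) (IH z) //= z0.
Qed.

Lemma min_ndiv_le_capacity (H H' : nat) (s : seq nat) :
  geodesic H H' s -> admissible H H' s -> min_ndiv H s <= geo_capacity H H'.
Proof.
move=> gs ads.
have sz : size (map (@inord H') s) == L_minus H H' + L_plus H H'.
  by rewrite size_map (size_geodesic gs).
have vs : map val (Tuple sz) = s.
  rewrite /= -map_comp -[RHS]map_id; apply/eq_in_map => z zs /=.
  by rewrite inordK // ltnS; apply: (allP ads); rewrite inE zs orbT.
rewrite -{1}vs; apply: (leq_bigmax_cond (F := fun u : _.-tuple _ => _)).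
by rewrite vs gs ads.
Qed.

Lemma capacity_attained (H H' : nat) (s : seq nat) :
    geodesic H H' s -> admissible H H' s ->
  exists s', [/\ geodesic H H' s', admissible H H' s' &
                 geo_capacity H H' = min_ndiv H s'].
Proof.
move=> gs ads.
have sz : size (map (@inord H') s) == L_minus H H' + L_plus H H'.
  by rewrite size_map (size_geodesic gs).
have vs : map val (Tuple sz) = s.
  rewrite /= -map_comp -[RHS]map_id; apply/eq_in_map => z zs /=.
  by rewrite inordK // ltnS; apply: (allP ads); rewrite inE zs orbT.
have Pu : geodesic H H' (map val (Tuple sz)) && admissible H H' (map val (Tuple sz)).
  by rewrite vs gs ads.
rewrite /geo_capacity (bigop.bigmax_eq_arg (Tuple sz)) //.
case: arg_maxnP => // u /andP[gu au] _.
by exists (map val u).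
Qed.

(* Main.v *)
(** Write [g = gcd H H'], so that [H = g * (t * r)] and [H' = g * I] with
    [r] the prime of the other deletion and [I] the product of the insertions,
    coprime to [t * r].  If every insertion were at a prime [q < t], then
    [x q = b q - a q] would be feasible in the packing problem, and
    [d H' <= d g * G_H (t, m) <= d H] contradicts that [H'] is highly composite.
    With an insertion [q >= t] available, delete [r], insert everything except
    [q], delete [t], and insert [q] last.  The largest vertex before the end is
    [g * t * (I / q) <= H'], and the two local minima of [d] are at [H / r] and
    [H' / q], where [d] is at least [d H / 2] and [d H' / 2]: removing one prime
    factor at most halves the number of divisors. *)

Require Import Defs.
From mathcomp Require Import all_boot all_order all_algebra.
From mathcomp Require Import zify.

Set Implicit Arguments.
Unset Strict Implicit.
Unset Printing Implicit Defensive.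

Import Order.TTheory GRing.Theory Num.Theory.

(** * Divisor counts *)

Lemma ndiv_gt0 (n : nat) : 0 < ndiv n.
Proof. by have := divisor1 n; rewrite /ndiv; case: (divisors n). Qed.

Lemma ndiv_dvd (m n : nat) : 0 < n -> m %| n -> ndiv m <= ndiv n.
Proof.
move=> n0 mn; have m0 := dvdn_gt0 n0 mn.
apply: uniq_leq_size; first exact: divisors_uniq.
by move=> d; rewrite -!dvdn_divisors // => dm; apply: dvdn_trans mn.
Qed.

(** A divisor of [n * p] is either [p] times a divisor of [n], or prime to [p] and then a divisor of
    [n]. This is the source of the constant 1/2. *)
Lemma ndiv_mul_prime (n p : nat) :
  0 < n -> prime p -> ndiv (n * p) <= 2 * ndiv n.
Proof.
move=> n0 pp; have p0 := prime_gt0 pp.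
rewrite /ndiv mul2n -addnn -[in X in _ + X](size_map (muln p)) -size_cat.
apply: uniq_leq_size; first exact: divisors_uniq.
move=> d; rewrite mem_cat -!dvdn_divisors ?muln_gt0 ?n0 // => dnp.
have [/dvdnP[e de]|pd] := boolP (p %| d).
  apply/orP; right; apply/mapP; exists e; last by rewrite de mulnC.
  by rewrite -dvdn_divisors // -(dvdn_pmul2r p0) -de.
by rewrite -(Gauss_dvdl n (p := p)) ?dnp // coprime_sym prime_coprime.
Qed.

Lemma size_add_divisors (f : nat * nat) (s : seq nat) :
  size (PrimeDecompAux.add_divisors f s) = f.2.+1 * size s.
Proof.
case: f => p e; rewrite /PrimeDecompAux.add_divisors /=.
elim: e => [|e IH] /=; first by rewrite mul1n.
by rewrite size_merge size_cat size_map IH [RHS]mulSn addnC.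
Qed.

(** Primes not dividing [n] contribute a factor 1, so a common range [N] lets two divisor counts be
    compared prime by prime. *)
Lemma ndivE (n N : nat) : 0 < n -> n < N ->
  ndiv n = \prod_(0 <= p < N | prime p) (logn p n).+1.
Proof.
move=> n0 nN.
have -> : ndiv n = \prod_(p <- primes n) (logn p n).+1.
  rewrite /ndiv /divisors prime_decompE.
  elim: (primes n) => [|p s IH]; first by rewrite big_nil.
  by rewrite big_cons -IH -(size_add_divisors (p, logn p n)).
have -> : \prod_(p <- primes n) (logn p n).+1
          = \prod_(p <- [seq q <- index_iota 0 N | q \in primes n]) (logn p n).+1.
  apply: perm_big; apply: uniq_perm; rewrite ?filter_uniq ?iota_uniq ?primes_uniq //.
  move=> p; rewrite mem_filter mem_index_iota /=.
  case pn: (p \in primes n) => //=.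
  move: pn; rewrite mem_primes => /and3P[_ _ pn].
  by rewrite (leq_ltn_trans (dvdn_leq n0 pn) nN).
rewrite big_filter big_mkcond [RHS]big_mkcond.
apply: eq_bigr => p _; rewrite mem_primes lognE n0 /=.
by case: (prime p) => //=; case: (p %| n).
Qed.

Lemma consecutive_hc_ndiv_lt (H H' : nat) : consecutive_hc H H' -> ndiv H < ndiv H'.
Proof. by case=> -[H0 _] [_ max'] HH' _; apply: max'; rewrite H0. Qed.

Lemma ltn_logn_mul (p m k : nat) :
  0 < m -> 0 < k -> prime p -> p %| k -> logn p m < logn p (m * k).
Proof.
move=> m0 k0 pp pk; rewrite lognM // -[X in X < _]addn0 ltn_add2l.
by rewrite logn_gt0 mem_primes pp k0.
Qed.

(** Prime factors of [k] are inserted one at a time, smallest first. The last conjunct serves twice: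
    [x %| z * k] bounds the vertices from above, [z %| x] bounds their divisor counts from below. *)
Lemma insertion_path (T z k : nat) : 0 < z -> 0 < k ->
    (forall p, prime p -> p %| k -> logn p (z * k) <= logn p T) ->
  exists s, [/\ path (geo_step T) z s, last z s = z * k &
                all (fun x => (z %| x) && (x %| z * k)) s].
Proof.
have [n] := ubnP k; elim: n z k => // n IH z k; rewrite ltnS => kn z0 k0 hk.
have [->|k1] := eqVneq k 1; first by exists [::]; rewrite muln1.
have k_gt1 : 1 < k by lia.
pose p := pdiv k; have pp : prime p := pdiv_prime k_gt1.
have /dvdnP[k' ek] : p %| k := pdiv_dvd k.
have p0 := prime_gt0 pp; have p1 := prime_gt1 pp.
have k'0 : 0 < k' by move: k0; rewrite ek muln_gt0 => /andP[].
have zpk : z * p * k' = z * k by rewrite ek -mulnA (mulnC p).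
have [||||s [sp sl sa]] := IH (z * p) k'; rewrite ?muln_gt0 ?z0 //.
- by apply: leq_trans kn; rewrite ek -{1}[k']muln1 ltn_pmul2l.
- by move=> r rp rk; rewrite zpk; apply: hk => //; rewrite ek dvdn_mulr.
exists (z * p :: s); split; rewrite /= ?sp ?sl ?zpk //.
- rewrite andbT; apply/hasP; exists p.
    by rewrite mem_primes pp !muln_gt0 z0 p0 /= dvdn_mull // dvdn_mull.
  rewrite eqxx andbT; apply/orP; left.
  apply: leq_trans (hk p pp _); last by rewrite ek dvdn_mull.
  by rewrite ltn_logn_mul // ek dvdn_mull.
- rewrite dvdn_mulr // -zpk dvdn_mulr //=.
  by apply/allP=> x /(allP sa) /andP[zx ->]; rewrite (dvdn_trans _ zx) ?dvdn_mulr.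
Qed.

(** * The deleted factor of [H] *)

Lemma required_deletionP (H H' p j : nat) : 0 < H -> 0 < H' ->
  required_deletion H H' p j ->
  prime p /\ p %| H %/ gcdn H H'.
Proof.
move=> H0 H'0 /andP[pp /andP[j1 j2]].
have lt : logn p H' < logn p H by apply: leq_trans j2.
split=> //; have g0 : 0 < gcdn H H' by rewrite gcdn_gt0 H0.
have := logn_div p (dvdn_gcdl H H'); rewrite logn_gcd // => e.
have : 0 < logn p (H %/ gcdn H H') by rewrite e; lia.
by rewrite logn_gt0 mem_primes => /and3P[].
Qed.

Lemma sum_logn_eq0 (n N : nat) : 0 < n -> n < N ->
  \sum_(0 <= p < N | prime p) logn p n = 0 -> n = 1.
Proof.
move=> n0 nN; rewrite big_mkord => /eqP; rewrite sum_nat_eq0 => /forallP l0.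
have [//|n1] := eqVneq n 1.
have n_gt1 : 1 < n by lia.
have pN : pdiv n < N by apply: leq_ltn_trans nN; apply: pdiv_leq.
have /implyP/(_ (pdiv_prime n_gt1)) /eqP /= e := l0 (Ordinal pN).
have : 0 < logn (pdiv n) n by rewrite logn_gt0 mem_primes pdiv_prime // n0 pdiv_dvd.
by rewrite e.
Qed.

Lemma sum_logn_prime (p N : nat) : prime p -> p < N ->
  \sum_(0 <= q < N | prime q) logn q p = 1.
Proof.
move=> pp pN; rewrite big_mkord (bigD1 (Ordinal pN)) //= logn_prime // eqxx.
rewrite big1 // => q /andP[qp]; rewrite -val_eqE /= => qne.
by rewrite logn_prime // (negbTE qne).
Qed.

(** The quotient has [L_minus H H' = 2] prime factors with multiplicity and is divisible by
    [p1 * p2], so the cofactor has none. *)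
Lemma two_deletions_quotient (H H' p1 j1 p2 j2 : nat) : 0 < H -> 0 < H' ->
    L_minus H H' = 2 -> required_deletion H H' p1 j1 ->
    required_deletion H H' p2 j2 -> (p1, j1) <> (p2, j2) ->
  H %/ gcdn H H' = p1 * p2.
Proof.
move=> H0 H'0 hL d1 d2 ne.
have [pp1 v1] := required_deletionP H0 H'0 d1.
have [pp2 v2] := required_deletionP H0 H'0 d2.
set c := H %/ _ in v1 v2 *.
have g0 : 0 < gcdn H H' by rewrite gcdn_gt0 H0.
have cE : c * gcdn H H' = H by apply: divnK; apply: dvdn_gcdl.
have c0 : 0 < c by move: H0; rewrite -{1}cE muln_gt0 => /andP[].
have lc p : logn p c = logn p H - logn p H'.
  by rewrite /c logn_div ?dvdn_gcdl // logn_gcd //; lia.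
have /dvdnP[e ce] : p1 * p2 %| c.
  have [p12|p12] := eqVneq p1 p2; last first.
    by rewrite Gauss_dvd ?v1 // prime_coprime // dvdn_prime2.
  (* Two distinct layers in one coordinate force the exponent to drop by at least 2. *)
  subst p2; rewrite mulnn pfactor_dvdn // lc.
  have jne : j1 <> j2 by move=> j12; apply: ne; rewrite j12.
  by case/and3P: d1 d2 => _ a b /and3P[_ c' d]; lia.
have e0 : 0 < e by move: c0; rewrite ce muln_gt0 => /andP[].
pose N := (H * H').+1.
have cH : c <= H by rewrite -cE leq_pmulr.
have cN : c < N by rewrite ltnS; apply: leq_trans cH _; rewrite leq_pmulr.
have sumc : \sum_(0 <= p < N | prime p) logn p c = 2.
  rewrite -hL /L_minus (@sum_primesE _ _ N) ?muln_gt0 ?H0 //.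
    by apply: eq_bigr => p _.
  move=> p pp; rewrite Euclid_dvdM // negb_or => /andP[pH _].
  by rewrite [logn p H]lognE (negbTE pH) !andbF.
have p1N := leq_ltn_trans (dvdn_leq c0 v1) cN.
have p2N := leq_ltn_trans (dvdn_leq c0 v2) cN.
have eN : e < N by apply: leq_ltn_trans cN; apply: dvdn_leq => //; rewrite ce dvdn_mulr.
have p10 := prime_gt0 pp1; have p20 := prime_gt0 pp2.
suff e1 : e = 1 by rewrite ce e1 mul1n.
apply: (sum_logn_eq0 e0 eN); move: sumc.
rewrite (eq_bigr (fun p => logn p e + (logn p p1 + logn p p2))); last first.
  by move=> p _; rewrite ce !lognM ?muln_gt0 ?p10.
rewrite !big_split (sum_logn_prime pp1 p1N) (sum_logn_prime pp2 p2N) => e2.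
by apply: (@addIn 2); exact: e2.
Qed.

(** * Existence of an insertion at or above [t] *)

(* The right-hand side is the product maximised by [packing] at
   [x q = logn q H' - logn q H]. *)
Lemma ndiv_ratio_small_insertions (H H' t : nat) : 0 < H -> 0 < H' ->
    (forall q, prime q -> q < t -> logn q H <= logn q H') ->
    (forall q, prime q -> t <= q -> logn q H' <= logn q H) ->
  ((ndiv H')%:R / (ndiv (gcdn H H'))%:R : rat)%R =
  (\prod_(q < t | prime q)
     ((logn q H + (logn q H' - logn q H)).+1%:R / (logn q H).+1%:R))%R.
Proof.
move=> H0 H'0 lo hi; have g0 : 0 < gcdn H H' by rewrite gcdn_gt0 H0.
pose N := (H' + gcdn H H' + t).+1.
rewrite (@ndivE H' N) ?(@ndivE (gcdn H H') N) //; try (rewrite /N; lia).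
rewrite !natr_prod -prodf_div (big_cat_nat (n := t)) //=; last by rewrite /N; lia.
(* From [t] on, [H'] and the gcd have equal exponents, so these factors are 1. *)
rewrite [X in (_ * X)%R]big_nat_cond [X in (_ * X)%R]big1 => [|q /andP[/andP[tq _] qp]].
  rewrite mulr1 big_mkord; apply: eq_bigr => q qp.
  by rewrite subnKC ?lo // logn_gcd // (minn_idPl (lo _ qp (ltn_ord q))).
by rewrite logn_gcd // (minn_idPr (hi _ qp tq)) divff // pnatr_eq0.
Qed.

(** This is the feasibility constraint of [packing] for the actual insertions. *)
Lemma L_plus_small_insertions (H H' t : nat) : 0 < H -> 0 < H' ->
    (forall q, prime q -> t <= q -> logn q H' <= logn q H) ->
  L_plus H H' = \sum_(q < t | prime q) (logn q H' - logn q H).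
Proof.
move=> H0 H'0 hi; pose N := (H * H' + t).+1.
rewrite /L_plus (@sum_primesE _ _ N) ?muln_gt0 ?H0 //; first last.
- move=> p pp; rewrite Euclid_dvdM // negb_or => /andP[_ pH].
  by rewrite [logn p H']lognE (negbTE pH) !andbF.
- by rewrite /N; lia.
rewrite (big_cat_nat (n := t)) //=; last by rewrite /N; lia.
rewrite [X in _ + X]big_nat_cond [X in _ + X]big1 => [|q /andP[/andP[tq _] qp]].
  by rewrite addn0 big_mkord.
by apply/eqP; rewrite subn_eq0 hi.
Qed.

Lemma insertion_above_exists (H H' t : nat) : 0 < H -> 0 < H' ->
    ndiv H < ndiv H' ->
    (forall q, prime q -> q < t -> logn q H <= logn q H') ->
    (((ndiv (gcdn H H'))%:R / (ndiv H)%:R : rat)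
       * packing H t (L_plus H H') <= 1)%R ->
  exists q : nat, required_insertion H H' q /\ t <= q.
Proof.
move=> H0 H'0 dlt lo hpack.
have [/hasP[q _ /andP[qi tq]]|/hasPn no] :=
  boolP (has (fun q => required_insertion H H' q && (t <= q)) (primes H')).
  by exists q.
have hi q : prime q -> t <= q -> logn q H' <= logn q H.
  move=> qp tq; have [qH'|] := boolP (q \in primes H').
    by have := no _ qH'; rewrite tq andbT /required_insertion qp /= -leqNgt.
  by rewrite -logn_gt0 -eqn0Ngt => /eqP ->.
have g0 : 0 < gcdn H H' by rewrite gcdn_gt0 H0.
have sumE := L_plus_small_insertions H0 H'0 hi.
(* The actual insertions as a packing vector; each coordinate is at most the total, so [inord] does
   not truncate it. *)
pose x := [ffun q : 'I_t =>
  (inord (if prime q then logn q H' - logn q H else 0) : 'I_(L_plus H H').+1)].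
have xE (q : 'I_t) : prime q -> x q = (logn q H' - logn q H) :> nat.
  move=> qp; rewrite ffunE qp inordK // ltnS sumE (bigD1 q) //=.
  exact: leq_addr.
have : ((ndiv H')%:R / (ndiv (gcdn H H'))%:R <= packing H t (L_plus H H'))%R.
  rewrite (ndiv_ratio_small_insertions H0 H'0 lo hi).
  rewrite (eq_bigr (fun q : 'I_t =>
    ((logn q H + x q).+1%:R / (logn q H).+1%:R)%R)); last first.
    by move=> q qp; rewrite xE.
  rewrite /packing; apply: (@le_bigmax_cond _ _ _ _ x _
    (fun y : {ffun 'I_t -> 'I_(L_plus H H').+1} => _)).
  by rewrite [X in _ == X]sumE; apply/eqP; apply: eq_bigr => q qp; rewrite xE.
have dg : (0 < (ndiv (gcdn H H'))%:R :> rat)%R by rewrite ltr0n ndiv_gt0.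
have dH : (0 < (ndiv H)%:R :> rat)%R by rewrite ltr0n ndiv_gt0.
rewrite ler_pdivrMr // => le1; move: hpack.
rewrite mulrAC ler_pdivrMr // mul1r mulrC => le2.
by have := le_trans le1 le2; rewrite ler_nat leqNgt dlt.
Qed.

(** * The geodesic and its minimum *)

Lemma leq_min_ndiv (b H : nat) (s : seq nat) :
  b <= ndiv H -> all (fun z => b <= ndiv z) s -> b <= min_ndiv H s.
Proof.
move=> bH /allP bs; rewrite /min_ndiv big_seq.
by apply: (big_ind (leq b)) => // m n bm bn; rewrite leq_min bm.
Qed.

(* With [c = gcd H H'] split off, [I] collects the insertions other than [q]. *)
Lemma delete_insert_geodesic (c r t q I : nat) :
    prime r -> prime t -> prime q -> 0 < c -> 0 < I ->
    coprime (t * r) (I * q) -> t <= q ->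
    c * t * r <= c * I * q ->
  exists s, [/\ geodesic (c * t * r) (c * I * q) s,
                admissible (c * t * r) (c * I * q) s &
                all (fun z => (c * t %| z) || (c * I %| z)) s].
Proof.
move=> rp tp qp c0 I0 cop tq le.
have [[r0 t0] q0] := (prime_gt0 rp, prime_gt0 tp, prime_gt0 qp).
move: cop; rewrite coprimeMl !prime_coprime // => /andP[tI rI].
have copI p : prime p -> p %| I -> ~~ (p %| t).
  by move=> pp pI; rewrite dvdn_prime2 //; apply: contraNneq tI => <-; rewrite dvdn_mulr.
have l0 p n : ~~ (p %| n) -> logn p n = 0.
  by move=> pn; rewrite lognE (negbTE pn) !andbF.
have [||p pp pI|s [sp sl sa]] := @insertion_path (c * I * q) (c * t) I; rewrite ?muln_gt0 ?c0 //.
  by rewrite !lognM ?muln_gt0 ?c0 ?I0 // (l0 p t) ?copI //; lia.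
(* Delete [r], insert [I] along [s] up to [c * t * I], delete [t], insert [q]. *)
exists (c * t :: s ++ [:: c * I; c * I * q]).
have mid x : x \in s -> 0 < x <= c * t * I.
  move=> /(allP sa) /andP[zx xw]; have w0 : 0 < c * t * I by rewrite !muln_gt0 c0 t0.
  by rewrite (dvdn_gt0 w0 xw) dvdn_leq.
(* The peak is admissible because [t <= q]. *)
have wle : c * t * I <= c * I * q by rewrite mulnAC leq_mul2l tq orbT.
split.
- apply/and3P; split.
  + rewrite /= all_cat /= !muln_gt0 c0 t0 r0 I0 q0 /= andbT.
    by apply/allP => x /mid /andP[].
  + rewrite /= cat_path /= sl sp /= andbT; apply/and3P; split.
    * apply/hasP; exists r.
        by rewrite mem_primes rp !muln_gt0 c0 t0 r0 /= dvdn_mulr // dvdn_mull.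
      apply/orP; right; rewrite eqxx andbT.
      by rewrite -mulnA lognM ?muln_gt0 ?I0 // (l0 r (I * q)) // !lognM ?muln_gt0 ?c0 //
        (logn_prime r rp) eqxx; lia.
    * apply/hasP; exists t.
        by rewrite mem_primes tp !muln_gt0 c0 t0 I0 /= dvdn_mulr // dvdn_mulr // dvdn_mull.
      apply/orP; right; rewrite (mulnAC c t I) eqxx andbT.
      by rewrite -mulnA lognM ?muln_gt0 ?I0 // (l0 t (I * q)) // !lognM ?muln_gt0 ?c0 //
        (logn_prime t tp) eqxx; lia.
    * apply/hasP; exists q.
        by rewrite mem_primes qp !muln_gt0 c0 I0 q0 /= dvdn_mull // dvdn_mull.
      apply/orP; left; rewrite eqxx andbT.
      by rewrite (lognM q _ q0) ?muln_gt0 ?c0 // (logn_prime q qp) eqxx addn1.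
  + by rewrite /= last_cat.
- rewrite /admissible /= all_cat /= le leqnn leq_pmulr //= andbT.
  rewrite (leq_trans _ le) ?leq_pmulr //=.
  by apply/allP => x /mid /andP[_ /leq_trans ->].
- rewrite /= all_cat /= !dvdnn (dvdn_mulr _ (dvdnn (c * I))) !orbT !andbT /=.
  by apply/allP => x /(allP sa) /andP[->].
Qed.

Theorem theorem6p4 (H H' p1 j1 p2 j2 t : nat)
  (hcons : consecutive_hc H H')
  (hL : L_minus H H' = 2)
  (hlayer1 : required_deletion H H' p1 j1)
  (hlayer2 : required_deletion H H' p2 j2)
  (hdistinct : (p1, j1) <> (p2, j2))
  (ht : t = if p1 == p2 then p1 else minn p1 p2)
  (hpack : (((ndiv (gcdn H H'))%:R / (ndiv H)%:R : rat)
            * packing H t (L_plus H H') <= 1)%R) :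
  (exists q : nat, required_insertion H H' q /\ t <= q)
  /\ (1 / 2%:R <= beta_geo H H')%R.
Proof.
have dlt := consecutive_hc_ndiv_lt hcons.
case: hcons => -[H0 _] [H'0 _] HH' _.
have quo := two_deletions_quotient H0 H'0 hL hlayer1 hlayer2 hdistinct.
have [pp1 _] := required_deletionP H0 H'0 hlayer1.
have [pp2 _] := required_deletionP H0 H'0 hlayer2.
have g0 : 0 < gcdn H H' by rewrite gcdn_gt0 H0.
(* [r] is the prime of the other deletion, equal to [t] when both lie in one coordinate. *)
have [r [tp rp tr tler]] : exists r,
    [/\ prime t, prime r, p1 * p2 = t * r & t <= r].
  rewrite ht; have [<-|ne] := eqVneq p1 p2; first by exists p1.
  by have [le|lt] := leqP p1 p2; [exists p2 | exists p1; rewrite mulnC ltnW].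
have HE : H = gcdn H H' * t * r.
  by rewrite -mulnA -tr -quo mulnC divnK ?dvdn_gcdl.
have [t0 r0] := (prime_gt0 tp, prime_gt0 rp).
(* Below [t] nothing is deleted: there [H] has the exponents of the gcd, which divides [H']. *)
have lo q : prime q -> q < t -> logn q H <= logn q H'.
  move=> qp qt; rewrite {1}HE !lognM ?muln_gt0 ?g0 ?t0 // (logn_prime _ tp) (logn_prime _ rp).
  by rewrite (ltn_eqF qt) (ltn_eqF (leq_trans qt tler)) !addn0 dvdn_leq_log // dvdn_gcdr.
have ex := insertion_above_exists H0 H'0 dlt lo hpack.
split=> //; case: ex => q [/andP[qp ql] tq].
set g := gcdn H H' in g0 HE quo *.
have q0 := prime_gt0 qp.
have H'E : H' = g * (H' %/ g) by rewrite mulnC divnK ?dvdn_gcdr.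
have cop : coprime (t * r) (H' %/ g).
  by rewrite /coprime -(eqn_pmul2l g0) muln_gcdr mulnA -HE -H'E muln1.
have qJ : q %| H' %/ g.
  have : 0 < logn q (H' %/ g).
    by rewrite logn_div ?dvdn_gcdr // logn_gcd //; lia.
  by rewrite logn_gt0 mem_primes => /and3P[].
case/dvdnP: qJ => I IE; rewrite {}IE in H'E cop.
have I0 : 0 < I by move: H'0; rewrite H'E !muln_gt0 => /and3P[].
rewrite mulnA in H'E.
have [|s [gs ads dvds]] := delete_insert_geodesic rp tp qp g0 I0 cop tq.
  by rewrite -HE -H'E ltnW.
rewrite -HE -H'E in gs ads.
have dH0 := ndiv_gt0 H.
rewrite /beta_geo ler_pdivlMr ?ltr0n // mul1r mulrC ler_pdivrMr ?ltr0n //.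
rewrite -natrM ler_nat.
apply: leq_trans (_ : min_ndiv H s * 2 <= _); last first.
  by rewrite leq_mul2r min_ndiv_le_capacity // orbT.
(* Rounding up is harmless: [uphalf n] is the least [b] with [n <= 2 * b]. *)
suff : uphalf (ndiv H) <= min_ndiv H s by rewrite leq_uphalf_double -muln2.
have all0 : {in s, forall z, 0 < z}.
  by case/and3P: gs => /= /andP[_ /allP p0] _ _ z zs; apply: p0.
apply: leq_min_ndiv; first by rewrite leq_uphalf_double -addnn leq_addr.
apply/allP => z zs; rewrite leq_uphalf_double -mul2n.
(* Each vertex is a multiple of [g * t], which is [H] without [r], or of [g * I], which is [H']
   without [q]; the second case also uses [ndiv H < ndiv H']. *)
case/orP: (allP dvds z zs) => /(ndiv_dvd (all0 z zs)) dz.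
  apply: leq_trans (_ : 2 * ndiv (g * t) <= _); last by rewrite leq_mul2l dz orbT.
  by rewrite {1}HE ndiv_mul_prime // muln_gt0 g0.
apply: leq_trans (_ : 2 * ndiv (g * I) <= _); last by rewrite leq_mul2l dz orbT.
by apply: leq_trans (ltnW dlt) _; rewrite {1}H'E ndiv_mul_prime // muln_gt0 g0.
Qed.
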